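(* Let $M$ be a real antisymmetric matrix of size $n$. Then $M$ is orthogonally antidiagonalizable to a real antisymmetric antidiagonal matrix whose antidiagonal consists of the eigenvalues of $M$ (with multiplicity, in some order) multiplied by $\imath=\sqrt{-1}$; that is, there are a real orthogonal matrix $R$ and such a matrix $A$ with $M=RAR^{-1}$. This orthogonal antidiagonalization is special orthogonal for even $n$ (i.e. $\det R=1$) and not special orthogonal for odd $n$ (i.e. $\det R=-1$).
   Context: An antidiagonal matrix of size $n$ is a matrix whose only nonzero entries are at positions $(i,n+1-i)$. An antidiagonalization of $M$ is a similarity $M=VAV^{-1}$ with $A$ antidiagonal; it is orthogonal if $V$ is orthogonal. *)

(* Defs.v *)
From HB Require Import structures.
From mathcomp Require Import all_boot all_order all_algebra.
From mathcomp Require Import complex.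
From mathcomp Require Import reals.

Set Implicit Arguments.
Unset Strict Implicit.
Unset Printing Implicit Defensive.

Import Order.TTheory GRing.Theory Num.Theory.
Local Open Scope ring_scope.
Local Open Scope complex_scope.

(* With 0-based indices, the position (i, n+1-i) is (i, rev_ord i). *)
Definition antidiagonal (K : nzRingType) (n : nat) (A : 'M[K]_n) : Prop :=
  forall i j : 'I_n, j != rev_ord i -> A i j = 0.

Definition antidiagonalization (K : comUnitRingType) (n : nat)
    (M V A : 'M[K]_n) : Prop :=
  [/\ V \in unitmx, antidiagonal A & M = V *m A *m invmx V].

Definition orthogonalmx (K : comUnitRingType) (n : nat) (V : 'M[K]_n) : Prop :=
  V *m V^T = 1%:M.

Definition orthogonal_antidiagonalization (K : comUnitRingType) (n : nat)
    (M V A : 'M[K]_n) : Prop :=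
  orthogonalmx V /\ antidiagonalization M V A.

(* lam lists the complex eigenvalues of the real matrix M, each repeated
   according to its algebraic multiplicity. *)
Definition eigenvalue_listing (R : realType) (n : nat) (M : 'M[R]_n)
    (lam : 'I_n -> R[i]) : Prop :=
  char_poly (map_mx (real_complex R) M) = \prod_(k < n) ('X - (lam k)%:P).

(* Main.v *)
(* If M <> 0, the Hermitian matrix 'i M has an eigenvector x + 'i y for a real
   eigenvalue d <> 0; antisymmetry makes x and y orthogonal of the same norm, so
   after scaling M maps x to d y and y to - d x. Two reflections send the first
   and last basis vectors to x and y, which leaves an antisymmetric matrix with
   a border of the required shape around a smaller antisymmetric matrix, and one
   concludes by induction. For the eigenvalues of an antisymmetric antidiagonal
   matrix A, char_poly A is also det (X + A), so its square is the determinant of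
   X^2 - A^2, which is diagonal. *)
Require Import Defs.
From mathcomp Require Import all_boot all_order all_algebra.
From mathcomp Require Import complex.
From mathcomp Require Import reals.

Import Order.TTheory GRing.Theory Num.Theory.
Local Open Scope ring_scope.
Local Open Scope complex_scope.

(** * Reflections of row vectors over an ordered field *)

Section Reflection.

Context {R : realFieldType} {n : nat}.
Implicit Types x y z : 'rV[R]_n.

Lemma dotrv_eq0 x : (x *m x^T == 0) = (x == 0).
Proof.
apply/eqP/eqP => [/matrixP/(_ 0 0) | ->]; last by rewrite mul0mx.
rewrite !mxE => /eqP; rewrite psumr_eq0 => [/allP h|j _]; last first.
  by rewrite mxE -expr2 sqr_ge0.
apply/rowP => j; rewrite mxE; have := h j (mem_index_enum _).
by rewrite mxE -expr2 sqrf_eq0 => /eqP.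
Qed.

Lemma dotrv_ge0 x : 0 <= (x *m x^T) 0 0.
Proof. by rewrite mxE sumr_ge0 // => j _; rewrite mxE -expr2 sqr_ge0. Qed.

Lemma dotrvC x y : x *m y^T = y *m x^T.
Proof.
by apply/matrixP=> i j; rewrite !ord1 -[x in LHS]trmxK -trmx_mul mxE.
Qed.

(** For [x != y], reflect in the hyperplane orthogonal to [w = x - y]. Equal norms give
    [2 <x, w> = <w, w>], so [x] loses exactly [w]; a vector orthogonal to [x] and [y] lies in the
    hyperplane. *)
Lemma exists_reflection x y : x *m x^T = y *m y^T ->
  exists H : 'M[R]_n, [/\ orthogonalmx H, x *m H = y
    & forall z, z *m x^T = 0 -> z *m y^T = 0 -> z *m H = z].
Proof.
move=> exy; have [<-|neq] := eqVneq x y.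
  by exists 1%:M; split=> [||z _ _]; rewrite ?/orthogonalmx ?trmx1 mulmx1.
pose w := x - y; pose c := (w *m w^T) 0 0.
have wwT : w *m w^T = c%:M by rewrite [LHS]mx11_scalar.
have c0 : c != 0.
  apply: contraNneq neq => c0; rewrite -subr_eq0 -dotrv_eq0 -/w wwT c0.
  by rewrite -scalemx1 scale0r.
have xwT : 2 *: (x *m w^T) = c%:M.
  rewrite -wwT {2}/w mulmxBl; suff -> : y *m w^T = - (x *m w^T).
    by rewrite opprK -mulr2n scaler_nat.
  by rewrite /w linearB /= !mulmxBr exy (dotrvC y x) opprB.
pose H := 1%:M - (2 / c) *: (w^T *m w).
have zH z : z *m H = z - (2 / c) *: (z *m w^T *m w).
  by rewrite /H mulmxBr mulmx1 -scalemxAr mulmxA.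
have HT : H^T = H by rewrite /H linearB /= linearZ /= trmx_mul trmxK trmx1.
exists H; split.
- rewrite /orthogonalmx HT {1}/H mulmxBl mul1mx -scalemxAl -mulmxA zH wwT.
  rewrite mul_scalar_mx scalerA divfK // scaler_nat mulr2n opprD addNKr.
  by rewrite /H mulmxN scalerN opprK subrK.
- rewrite zH mulrC -scalerA scalemxAl xwT mul_scalar_mx scalerA mulVf //.
  by rewrite scale1r subKr.
- move=> z zx zy; have zw : z *m w^T = 0.
    by rewrite /w linearB /= mulmxBr zx zy subr0.
  by rewrite zH zw mul0mx scaler0 subr0.
Qed.

(** A reflection [H1] sends [e] to [u]. A reflection [H2], applied before it, sends [f] to the
    preimage of [v] under [H1]; it fixes [e], which is orthogonal to [f] and to that preimage. *)
Lemma exists_orthogonal_pair (e f u v : 'rV[R]_n) :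
  e *m e^T = 1%:M -> f *m f^T = 1%:M -> e *m f^T = 0 ->
  u *m u^T = 1%:M -> v *m v^T = 1%:M -> u *m v^T = 0 ->
  exists O : 'M[R]_n, [/\ orthogonalmx O, e *m O = u & f *m O = v].
Proof.
move=> ee ff ef uu vv uv.
have [H1 [oH1 eH1 _]] := exists_reflection e u (etrans ee (esym uu)).
have oH1' : H1^T *m H1 = 1%:M by exact: mulmx1C.
pose w := v *m H1^T.
have ww : w *m w^T = 1%:M.
  by rewrite trmx_mul trmxK mulmxA -(mulmxA v) oH1' mulmx1.
have ew : e *m w^T = 0 by rewrite trmx_mul trmxK mulmxA eH1.
have [H2 [oH2 fH2 fixH2]] := exists_reflection f w (etrans ff (esym ww)).
exists (H2 *m H1); split.
- by rewrite /orthogonalmx trmx_mul mulmxA -(mulmxA H2) oH1 mulmx1.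
- by rewrite mulmxA fixH2.
- by rewrite mulmxA fH2 -mulmxA oH1' mulmx1.
Qed.

End Reflection.

(** * Real planes invariant under an antisymmetric matrix *)

Section Skew.

Context {R : rcfType}.

Lemma complexmx_inj m n (a b a' b' : 'M[R]_(m, n)) :
  let C := map_mx (real_complex R) in
  C a + 'i *: C b = C a' + 'i *: C b' -> a = a' /\ b = b'.
Proof.
move=> C /matrixP e; split; apply/matrixP=> i j; have := e i j; rewrite !mxE;
  by simpc => -[].
Qed.

Lemma skew_eigenpair n (M : 'M[R]_n) : M^T = - M -> M != 0 ->
  exists (u v : 'rV[R]_n) (d : R),
    [/\ u *m u^T = 1%:M, v *m v^T = 1%:M, u *m v^T = 0,
        u *m M = d *: v & v *m M = - d *: u].
Proof.
move=> skM M0; pose C := @map_mx _ _ (real_complex R).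
pose B := 'i *: C n n M.
have herB : B \is hermsymmx.
  apply/is_hermitianmxP; rewrite expr0 scale1r; apply/matrixP => i j.
  rewrite !mxE rmorphM /= conjCi conj_Creal ?complex_real //.
  have /matrixP/(_ i j) := skM; rewrite !mxE => ->.
  by rewrite raddfN mulrNN.
have [P0 [D [Pu DB Dr]]] : exists (P : 'M[R[i]]_n) D,
  [/\ P \in unitmx, P *m B = diag_mx D *m P & D \is a realmx].
  exists (spectralmx B), (spectral_diag B); split.
  - exact: spectral_unit.
  - have /orthomx_spectralP {2}-> := hermitian_normalmx herB.
    by rewrite !mulmxA mulmxV ?spectral_unit // mul1mx.
  - exact: hermitian_spectral_diag_real.
(* If all eigenvalues of [B] were zero, [B] and hence [M] would vanish. *)
have [k Dk] : exists k, D 0 k != 0.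
  apply/existsP; apply: contraNT M0; rewrite negb_exists => /forallP h.
  have D0 : D = 0.
    by apply/rowP => k; rewrite mxE; apply/eqP; rewrite -[_ == _]negbK.
  have : B == 0 by rewrite -(mulKmx Pu B) DB D0 linear0 mul0mx mulmx0.
  rewrite scaler_eq0 -complexiE /= eq_complex /= oner_eq0 andbF /=.
  by rewrite map_mx_eq0.
pose w := row k P0.
pose x := map_mx (@complex.Re R) w; pose y := map_mx (@complex.Im R) w.
have w0 : w != 0.
  apply/eqP => w0; have : delta_mx 0 k *m P0 *m invmx P0 = 0 :> 'rV_n.
    by rewrite -rowE -/w w0 mul0mx.
  by rewrite mulmxK // => /matrixP/(_ 0 k)/eqP; rewrite !mxE !eqxx oner_eq0.
pose d := complex.Re (D 0 k).
have dE : D 0 k = d%:C by rewrite RRe_real //; exact: (mxOverP Dr).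
have wE : w = C _ _ x + 'i *: C _ _ y.
  by apply/rowP => j; rewrite !mxE; case: (P0 k j) => a b /=; simpc.
have wB : w *m B = D 0 k *: w.
  by rewrite -row_mul DB row_mul row_diag_mx -scalemxAl -rowE.
(* Compare real and imaginary parts in [w *m B = d *: w], where [w *m B] has real part [- y *m M]
   and imaginary part [x *m M]. *)
have [yM xM] : - (y *m M) = d *: x /\ x *m M = d *: y.
  apply: complexmx_inj.
  transitivity (w *m B); last first.
    by rewrite wB dE {1}wE !map_mxZ scalerDr !scalerA mulrC.
  rewrite {1}wE -scalemxAr mulmxDl -scalemxAl -!map_mxM scalerDr scalerA.
  by rewrite -complexiE -expr2 sqr_i scaleN1r addrC map_mxN.
have d0 : d != 0 by apply: contraNneq Dk; rewrite dE => ->.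
have dot_skew (z t : 'rV_n) : z *m M *m t^T = - (z *m (t *m M)^T).
  by rewrite trmx_mul skM mulNmx mulmxN opprK mulmxA.
have yM' : y *m M = - d *: x by rewrite -[LHS]opprK yM scaleNr.
(* Antisymmetry on the pair [x], [x] reads [d <y, x> = - d <x, y>], so [2 d <x, y> = 0]. *)
have xy : x *m y^T = 0.
  apply/eqP; have /eqP := dot_skew x x; rewrite xM linearZ /= -scalemxAl.
  rewrite -scalemxAr -(dotrvC x) -addr_eq0 -mulr2n -scaler_nat scalerA.
  by rewrite scaler_eq0 mulf_eq0 pnatr_eq0 (negPf d0).
(* Antisymmetry on the pair [x], [y] reads [d <y, y> = d <x, x>]. *)
have xx_yy : x *m x^T = y *m y^T.
  apply/eqP; have /eqP := dot_skew x y; rewrite xM yM' linearZ /= -scalemxAl.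
  rewrite -scalemxAr scaleNr opprK -subr_eq0 -scalerBr scaler_eq0 (negPf d0).
  by rewrite subr_eq0 eq_sym.
pose N := (x *m x^T) 0 0.
have xxN : x *m x^T = N%:M by rewrite [LHS]mx11_scalar.
have N_gt0 : 0 < N.
  rewrite lt_def dotrv_ge0 andbT.
  apply: contraNneq w0 => N0; rewrite wE.
  have /eqP -> : x == 0 by rewrite -dotrv_eq0 xxN N0 raddf0.
  have /eqP -> : y == 0 by rewrite -dotrv_eq0 -xx_yy xxN N0 raddf0.
  by rewrite /C !map_mx0 scaler0 addr0.
pose r := (Num.sqrt N)^-1.
have rrN : r * r * N = 1.
  by rewrite -expr2 exprVn sqr_sqrtr ?ltW // mulVf // gt_eqF.
have dotZ (z t : 'rV_n) : (r *: z) *m (r *: t)^T = (r * r) *: (z *m t^T).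
  by rewrite linearZ /= -scalemxAl -scalemxAr scalerA.
exists (r *: x), (r *: y), d; split.
- by rewrite dotZ xxN scale_scalar_mx rrN.
- by rewrite dotZ -xx_yy xxN scale_scalar_mx rrN.
- by rewrite dotZ xy scaler0.
- by rewrite -scalemxAl xM !scalerA mulrC.
- by rewrite -scalemxAl yM' !scalerA mulrC.
Qed.

(** * Bordered matrices and the induction on the size *)

Definition border {m} (d : R) (X : 'M[R]_m) : 'M[R]_(1 + (m + 1)) :=
  block_mx 0 (row_mx 0 d%:M) (col_mx 0 (- d)%:M) (block_mx X 0 0 0).

(** The last two hypotheses are the first and last rows of [N]. Antisymmetry turns them into the
    first and last columns and passes to the central block. *)
Lemma border_skew m (d : R) (N : 'M[R]_(1 + (m + 1))) : N^T = - N ->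
  row_mx 1%:M 0 *m N = d *: row_mx 0 (row_mx 0 1%:M) ->
  row_mx 0 (row_mx 0 1%:M) *m N = - d *: row_mx 1%:M 0 ->
  exists X : 'M[R]_m, X^T = - X /\ N = border d X.
Proof.
rewrite -[N]submxK -[drsubmx N]submxK.
move: (ulsubmx N) (ursubmx N) (dlsubmx N) (ulsubmx (drsubmx N)) => a b c e.
move: (ursubmx (drsubmx N)) (dlsubmx (drsubmx N)) (drsubmx (drsubmx N)).
move=> f g h.
rewrite !tr_block_mx !opp_block_mx => /eq_block_mx[_ cb _].
move=> /eq_block_mx[ee gf _ _].
rewrite !mul_row_block !(mul1mx, mul0mx, addr0, add0r).
rewrite !scale_row_mx !scaler0 !scalemx1.
move=> /eq_row_mx[-> b_eq] /eq_row_mx[_]; rewrite -row_mx0 => /eq_row_mx[g0 h0].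
exists e; split=> //; rewrite /border; congr block_mx => //.
  rewrite -[c]trmxK cb b_eq linearN /= tr_row_mx.
  by rewrite opp_col_mx trmx0 tr_scalar_mx oppr0 raddfN.
by rewrite g0 h0 -[f]opprK -gf g0 trmx0 oppr0.
Qed.

Lemma border_antidiagonal m d (X : 'M[R]_m) :
  antidiagonal X -> antidiagonal (border d X).
Proof.
move=> adX i j; rewrite -(inj_eq val_inj) /border /=.
case: (split_ordP i) => {}i -> /=; case: (split_ordP j) => {}j -> /=.
- by rewrite block_mxEul mxE.
- rewrite block_mxEur; case: (split_ordP j) => {}j -> /=.
    by rewrite row_mxEl mxE.
  by rewrite !ord1 => /eqP[]; rewrite /= addn1 addn0 subn1.
- rewrite block_mxEdl; case: (split_ordP i) => {}i -> /=.
    by rewrite col_mxEu mxE.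
  by rewrite !ord1 => /eqP[]; rewrite /= addn1 addn0 add1n subnn.
- rewrite block_mxEdr; case: (split_ordP i) => {}i ->;
    case: (split_ordP j) => {}j -> /=;
    rewrite ?(block_mxEul, block_mxEur, block_mxEdl, block_mxEdr) ?mxE //.
  (* Central indices are shifted by one, and reversing [1 + i] in size [m + 2] gives one plus the
     reversal of [i] in size [m]. *)
  move=> neq; apply: adX; rewrite -(inj_eq val_inj) /=.
  apply: contraNneq neq => ->.
  by rewrite !add1n addn1 subSS subSn.
Qed.

Lemma skew_antidiagonalization n (M : 'M[R]_n) : M^T = - M ->
  exists Q A : 'M[R]_n,
    [/\ orthogonalmx Q, antidiagonal A, A^T = - A & M = Q *m A *m Q^T].
Proof.
elim/ltn_ind: n M => n IHn M skM.
have [->|M0] := eqVneq M 0.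
  exists 1%:M, 0; split; rewrite /orthogonalmx ?mulmx0 ?mul0mx ?trmx1 ?mulmx1 //.
  - by move=> i j _; rewrite mxE.
  - by rewrite trmx0 oppr0.
(* A nonzero antisymmetric matrix has size at least two: in size one the entry is its own
   opposite. *)
have [m n_eq] : exists m, n = (1 + (m + 1))%N.
  case: n M M0 skM {IHn} => [|[|m]] M M0 skM; last by exists m; rewrite addn1.
  - by rewrite [M]flatmx0 eqxx in M0.
  - case/negP: M0; have /matrixP/(_ 0 0)/eqP := skM.
    rewrite !mxE -addr_eq0 -mulr2n mulrn_eq0 => /eqP M00.
    by rewrite [M]mx11_scalar M00 raddf0.
subst n.
have [u [v [d [uu vv uv uM vM]]]] := skew_eigenpair _ _ skM M0.
pose e0 : 'rV[R]_(1 + (m + 1)) := row_mx 1%:M 0.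
pose e1 : 'rV[R]_(1 + (m + 1)) := row_mx 0 (row_mx 0 1%:M).
have e00 : e0 *m e0^T = 1%:M.
  by rewrite tr_row_mx mul_row_col trmx1 mulmx1 mul0mx addr0.
have e11 : e1 *m e1^T = 1%:M.
  by rewrite !tr_row_mx !mul_row_col trmx1 mulmx1 !mul0mx !add0r.
have e01 : e0 *m e1^T = 0.
  by rewrite !tr_row_mx mul_row_col mul0mx trmx0 mulmx0 addr0.
have [O [oO e0O e1O]] := exists_orthogonal_pair _ _ _ _ e00 e11 e01 uu vv uv.
have uO : u *m O^T = e0 by rewrite -e0O -mulmxA oO mulmx1.
have vO : v *m O^T = e1 by rewrite -e1O -mulmxA oO mulmx1.
have oO' : O^T *m O = 1%:M by exact: mulmx1C.
(* [N] is [M] written in an orthonormal basis with first vector [u] and last vector [v]. *)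
pose N := O *m M *m O^T.
have skN : N^T = - N.
  by rewrite !trmx_mul trmxK skM mulNmx mulmxN mulmxA.
have e0N : e0 *m N = d *: e1.
  by rewrite !mulmxA e0O uM -scalemxAl vO.
have e1N : e1 *m N = - d *: e0.
  by rewrite !mulmxA e1O vM -scalemxAl uO.
have ME : M = O^T *m N *m O.
  by rewrite /N -!mulmxA oO' mulmx1 mulmxA oO' mul1mx.
clearbody N.
have [N' [skN' NE]] := border_skew _ _ _ skN e0N e1N.
have m_lt : (m < 1 + (m + 1))%N by rewrite add1n addn1 ltnS leqnSn.
have [Q' [A' [oQ' adA' skA' N'E]]] := IHn m m_lt N' skN'.
(* Conjugating a bordered matrix by this one acts on the central block alone and keeps the corners
   [d] and [- d]. *)
pose Q2 : 'M[R]_(1 + (m + 1)) := block_mx 1%:M 0 0 (block_mx Q' 0 0 1%:M).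
have oQ2 : Q2 *m Q2^T = 1%:M.
  rewrite !tr_block_mx !trmx0 !trmx1 !mulmx_block.
  rewrite !(mulmx0, mul0mx, mulmx1, addr0, add0r).
  by rewrite oQ' -!scalar_mx_block.
exists (O^T *m Q2), (border d A'); split.
- rewrite /orthogonalmx trmx_mul trmxK mulmxA -(mulmxA O^T) oQ2 mulmx1.
  exact: oO'.
- exact: border_antidiagonal.
- rewrite /border !tr_block_mx tr_row_mx tr_col_mx skA' !trmx0 !tr_scalar_mx.
  by rewrite !opp_block_mx opp_row_mx opp_col_mx !oppr0 !raddfN /= opprK.
- rewrite ME trmx_mul trmxK !mulmxA; congr (_ *m O).
  rewrite -!mulmxA; congr (_ *m _); rewrite NE N'E /border.
  rewrite !tr_block_mx !trmx0 !trmx1.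
  do 2 rewrite !mulmx_block !(mulmx0, mul0mx, mulmx1, mul1mx, addr0, add0r).
  rewrite !(mul_row_block, mul_block_col).
  by rewrite !(mulmx0, mul0mx, mulmx1, mul1mx, addr0, add0r) ?mulmxA.
Qed.

End Skew.

(** * Characteristic polynomials *)

Lemma char_poly_conj (K : comNzRingType) n (P P' A : 'M[K]_n) :
  P *m P' = 1%:M -> char_poly (P *m A *m P') = char_poly A.
Proof.
move=> PP'; have PPp : map_mx polyC P *m map_mx polyC P' = 1%:M.
  by rewrite -map_mxM PP' map_mx1.
have -> : char_poly (P *m A *m P') =
    \det (map_mx polyC P *m char_poly_mx A *m map_mx polyC P').
  congr (\det _); rewrite /char_poly_mx mulmxBr mulmxBl -!map_mxM; congr (_ - _).
  by rewrite scalar_mxC -mulmxA PPp mulmx1.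
by rewrite !det_mulmx mulrAC -det_mulmx PPp det1 mul1r.
Qed.

(** Both sides are monic with the same square. The opposite signs of [lam] at mirror positions make
    the product of the ['X + lam k] equal to that of the ['X - lam k], so the latter squared is the
    product of the ['X^2 - lam k ^+ 2]. *)
Lemma char_poly_skew_antidiagonal (K : numDomainType) n (A : 'M[K]_n)
    (lam : 'I_n -> K) :
  antidiagonal A -> A^T = - A ->
  (forall k, lam k ^+ 2 = - A k (rev_ord k) ^+ 2) ->
  (forall k, lam (rev_ord k) = - lam k) ->
  char_poly A = \prod_(k < n) ('X - (lam k)%:P).
Proof.
move=> adA skA lam2 lamN; set q := \prod_(k < n) _.
have q_monic : q \is monic by exact: monic_prod_XsubC.
(* Row [i] of [A] lives at [rev_ord i] only, and the two mirror entries are opposite, so their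
   product is minus a square. *)
have AA : A *m A = diag_mx (\row_k lam k ^+ 2).
  apply/matrixP => i j; rewrite !mxE (bigD1 (rev_ord i)) //= big1 ?addr0.
    have /matrixP/(_ i (rev_ord i)) := skA; rewrite !mxE => skAi.
    have [<-|neq] := eqVneq i j; first by rewrite lam2 skAi mulrN mulr1n.
    by rewrite [A _ j]adA ?mulr0 ?mulr0n // rev_ordK eq_sym.
  by move=> k neq; rewrite adA ?mul0r.
have qN : \prod_(k < n) ('X + (lam k)%:P) = q.
  rewrite (reindex_inj rev_ord_inj); apply: eq_bigr => k _.
  by rewrite lamN polyCN.
have sqE : char_poly A ^+ 2 = q ^+ 2.
  have trE : char_poly A = \det ('X%:M + map_mx polyC A).
    by rewrite /char_poly -det_tr /char_poly_mx linearB /= tr_scalar_mx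
               map_trmx skA map_mxN opprK.
  rewrite expr2 {2}trE /char_poly -det_mulmx /char_poly_mx.
  rewrite mulmxBl !mulmxDr -map_mxM AA.
  rewrite -(scalar_mxC _ (map_mx polyC A)) opprD addrA addrK.
  rewrite -scalar_mxM map_diag_mx -diag_const_mx -raddfB /= det_diag.
  rewrite [RHS]expr2 -{1}qN -big_split /=; apply: eq_bigr => k _.
  by rewrite !mxE rmorphXn /= [RHS]mulrC -subr_sqr expr2.
(* Equal squares leave a sign; the wrong one would give [1 = -1] on leading coefficients. *)
have /eqP := sqE; rewrite eqf_sqr => /orP[/eqP-> //|/eqP pN].
have := monicP (char_poly_monic A).
rewrite pN lead_coefN (monicP q_monic) => /eqP.
by rewrite eq_sym -addr_eq0 -mulr2n pnatr_eq0.
Qed.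

(** * Adjusting the determinant *)

Lemma det_orthogonalmx (R : idomainType) n (Q : 'M[R]_n) :
  orthogonalmx Q -> (\det Q == 1) || (\det Q == -1).
Proof.
by move=> oQ; rewrite -sqrf_eq1 expr2 -{2}det_tr -det_mulmx oQ det1.
Qed.

(* Flipping the sign of the first column of an orthogonal matrix changes its
   determinant, while conjugating [A] by the corresponding reflection only
   changes signs on its antidiagonal. *)
Lemma skew_antidiagonalization_det (R : rcfType) n (M : 'M[R]_n) :
  M^T = - M ->
  exists Q A : 'M[R]_n,
    [/\ orthogonalmx Q, antidiagonal A, A^T = - A, M = Q *m A *m Q^T
      & \det Q = (-1) ^+ n].
Proof.
move=> skM; have [Q [A [oQ adA skA ME]]] := skew_antidiagonalization _ M skM.
have [dQ|dQ] := eqVneq (\det Q) ((-1) ^+ n); first by exists Q, A.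
(* In size zero there is no column to flip, but the determinant is already [1]. *)
case: n => [|n] in M skM Q A oQ adA skA ME dQ *.
  by rewrite det_mx00 expr0 eqxx in dQ.
pose D : 'M[R]_n.+1 := diag_mx (\row_j (-1) ^+ (j == 0)).
have DT : D^T = D by rewrite tr_diag_mx.
have DD : D *m D = 1%:M.
  rewrite mulmx_diag -diag_const_mx; congr diag_mx; apply/rowP => j.
  by rewrite !mxE -signr_addb addbb.
have dD : \det D = -1.
  rewrite det_diag big_ord_recl big1 ?mxE ?mulr1 // => j _.
  by rewrite mxE.
exists (Q *m D), (D *m A *m D); split.
- by rewrite /orthogonalmx trmx_mul DT mulmxA -(mulmxA Q) DD mulmx1.
- move=> i j neq; rewrite mul_mx_diag mul_diag_mx !mxE adA //.
  by rewrite mulr0 mul0r.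
- by rewrite !trmx_mul DT skA mulNmx mulmxN mulmxA.
- rewrite trmx_mul DT ME !mulmxA -(mulmxA Q D D) DD mulmx1.
  by rewrite -(mulmxA _ D D) DD mulmx1.
(* [\det Q] is a sign other than the required one, so its opposite is the required one. *)
- rewrite det_mulmx dD mulrN1; move: dQ.
  have /orP[/eqP-> | /eqP->] := det_orthogonalmx _ _ _ oQ; rewrite -signr_odd;
    by case: (odd _) => //=; rewrite ?expr0 ?expr1 ?opprK ?eqxx.
Qed.

(** * Complex eigenvalues and the parity of the size *)

Theorem corollary4p10 (R : realType) (n : nat) (M : 'M[R]_n) :
  M \is skewmx ->
  exists (Q A : 'M[R]_n) (lam : 'I_n -> R[i]),
    [/\ orthogonal_antidiagonalization M Q A,
        A \is skewmx,
        eigenvalue_listing M lam,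
        forall k : 'I_n, (A k (rev_ord k))%:C = 'i%C * lam k
      & (~~ odd n -> \det Q = 1) /\ (odd n -> \det Q = -1)].
Proof.
(* [skewmx] is the hermitian condition with sign [-1] and the identity as conjugation. *)
have skewE (X : 'M[R]_n) : (X \is skewmx) = (X^T == - X).
  rewrite is_hermitianmxE expr1 scaleN1r (map_mx_id (frefl idfun)).
  by rewrite eq_sym eqr_oppLR.
rewrite skewE => /eqP skM.
have [Q [A [oQ adA skA ME dQ]]] := skew_antidiagonalization_det _ _ _ skM.
have [Qu _] := mulmx1_unit oQ.
have QV : invmx Q = Q^T by rewrite -[RHS]mul1mx -(mulVmx Qu) -mulmxA oQ mulmx1.
have ii : 'i%C * 'i%C = -1 :> R[i] by exact: sqr_i.
(* The listing is found by solving ['i * lam k = A k (rev_ord k)] for [lam k]. *)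
exists Q, A, (fun k => - 'i%C * (A k (rev_ord k))%:C); split.
- by split=> //; split=> //; rewrite QV.
- by rewrite skewE skA.
- rewrite /eigenvalue_listing -map_char_poly ME char_poly_conj // map_char_poly.
  apply: char_poly_skew_antidiagonal => [i j neq||k|k].
  + by rewrite mxE adA // rmorph0.
  + by rewrite map_trmx skA map_mxN.
  + by rewrite mxE exprMn sqrrN expr2 ii mulN1r.
  + have /matrixP/(_ k (rev_ord k)) := skA; rewrite !mxE rev_ordK => ->.
    by rewrite rmorphN mulrN.
- by move=> k; rewrite mulrA mulrN ii opprK mul1r.
- by rewrite dQ -signr_odd; split=> [/negPf->|->]; rewrite ?expr0 ?expr1.
Qed.
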